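(* Let $g:\mathbb{R}^n\to\mathbb{R}^n$ be the closed-loop map of the discrete-time system $x_{t+1}=g(x_t)$, and let $x^*$ be an equilibrium, $g(x^* )=x^*$. Let $\mathcal{B}=\prod_{i=1}^n[\ell_i,u_i]\subset\mathbb{R}^n$ be a box with $x^*\in\mathcal{B}$, and let $\kappa>0$. Let $V:\mathbb{R}^n\to\mathbb{R}$ be a function with $V(x^* )=0$ and $V(x)>0$ for all $x\neq x^*$. Define $F(x):=V(g(x))-(1-\kappa)V(x)$. Suppose that for some $\rho>0$ the condition $$\bigl(-F(x)\ge 0\ \wedge\ g(x)\in\mathcal{B}\bigr)\ \vee\ \bigl(V(x)\ge\rho\bigr)$$ holds for all $x\in\mathcal{B}$. Then the set $$\mathcal{S}:=\{x\in\mathcal{B}\mid V(x)<\rho\}$$ is a certified inner approximation of the region of attraction for the closed-loop system $x_{t+1}=g(x_t)$, i.e. $\mathcal{S}$ is a subset of the region of attraction of $x^*$.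
   Context: The closed-loop map is $g(x)=f(x,\pi(x))$, where $f$ is the dynamics and $\pi$ a state-feedback controller. Throughout, $f$ and $\pi$ are assumed to be computation graphs, i.e. functions given by finite directed acyclic graphs of elementary operations (arithmetic, standard elementary functions, neural network activations, linear maps, and the like). The region of attraction of $x^*$ is the set of initial states $x_0$ for which the trajectory $x_{t+1}=g(x_t)$ starting at $x_0$ satisfies $\lim_{t\to\infty}x_t=x^*$.
   Formalization: The function V is additionally assumed continuous on the box B; for an arbitrary discontinuous V the claim fails, e.g. for an irrational rotation of the plane with V halving along one orbit on the unit circle, zero at the origin and equal to 1 elsewhere. *)

(* Defs.v *)
From mathcomp Require Import all_boot all_order all_algebra.
From mathcomp Require Import all_classical all_reals all_analysis.
Import Order.TTheory GRing.Theory Num.Theory.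
Import numFieldNormedType.Exports.

Set Implicit Arguments.
Unset Strict Implicit.
Unset Printing Implicit Defensive.

Local Open Scope classical_set_scope.
Local Open Scope ring_scope.

(* A finite directed acyclic graph, given in a topological order of its nodes:
   [node_values Op G] says that [G x] is the concatenation of the values of all
   the nodes on input [x].  The sources are the coordinates of [x]; each further
   node applies an elementary operation [h] to coordinates, selected by the
   wiring [w], of the values already computed.  [Op] is the library of
   elementary operations; constants are the operations of arity [k = 0]. *)
Inductive node_values (R : realType)
    (Op : forall k p : nat, ('rV[R]_k -> 'rV[R]_p) -> Prop) (n : nat) :
    forall N : nat, ('rV[R]_n -> 'rV[R]_N) -> Prop :=
| input_nodes : node_values Op (fun x : 'rV[R]_n => x)
| operation_node (N k p : nat) (G : 'rV[R]_n -> 'rV[R]_N)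
    (w : 'I_k -> 'I_N) (h : 'rV[R]_k -> 'rV[R]_p) :
    node_values Op G -> Op k p h ->
    node_values Op (fun x => row_mx (G x) (h (colsub w (G x)))).

(* The output is read off from selected coordinates of the node values. *)
Definition computation_graph (R : realType)
    (Op : forall k p : nat, ('rV[R]_k -> 'rV[R]_p) -> Prop) (n m : nat)
    (F : 'rV[R]_n -> 'rV[R]_m) : Prop :=
  exists (N : nat) (G : 'rV[R]_n -> 'rV[R]_N) (w : 'I_m -> 'I_N),
    node_values Op G /\ forall x, F x = colsub w (G x).

Definition closed_loop (R : realType) (n m : nat)
    (f : 'rV[R]_(n + m) -> 'rV[R]_n) (ctrl : 'rV[R]_n -> 'rV[R]_m) :
    'rV[R]_n -> 'rV[R]_n :=
  fun x => f (row_mx x (ctrl x)).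

Definition box (R : realType) (n : nat) (l u : 'rV[R]_n) : set 'rV[R]_n :=
  [set x | forall i : 'I_n, l ord0 i <= x ord0 i <= u ord0 i].

Definition region_of_attraction (R : realType) (n : nat)
    (g : 'rV[R]_n -> 'rV[R]_n) (xstar : 'rV[R]_n) : set 'rV[R]_n :=
  [set x0 | (fun t : nat => iter t g x0) @ \oo --> xstar].

Definition lyapunov_residual (R : realType) (n : nat)
    (g : 'rV[R]_n -> 'rV[R]_n) (V : 'rV[R]_n -> R) (kappa : R)
    (x : 'rV[R]_n) : R :=
  V (g x) - (1 - kappa) * V x.

(* Main.v *)
(* Along a trajectory issued from [x0] in the sublevel set, the condition keeps
   the state in the box and gives [V (x_t) <= q ^ t * V x0] with
   [q = max(0, 1 - kappa) < 1], so [V (x_t)] tends to [0].  As [V] is continuous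
   on the compact box and vanishes only at [xstar], this forces [x_t] to tend to
   [xstar]. *)
Require Import Defs.
From mathcomp Require Import all_boot all_order all_algebra.
From mathcomp Require Import all_classical all_reals all_analysis.
Import Order.TTheory GRing.Theory Num.Theory.
Import numFieldNormedType.Exports.

Set Implicit Arguments.
Unset Strict Implicit.
Unset Printing Implicit Defensive.

Local Open Scope classical_set_scope.
Local Open Scope ring_scope.

(* For an open neighborhood [U] of [p], the image of [K `\` U] is compact, hence
   closed, and misses [V p]; so [V x] close to [V p] puts [x] in [U]. *)
Lemma cvg_of_image_cvg (T S : topologicalType) (F : set_system T)
    (K : set T) (V : T -> S) (p : T) :
  Filter F -> hausdorff_space S -> compact K -> {within K, continuous V} ->
  (forall x, K x -> V x = V p -> x = p) ->
  F K -> V @ F --> V p -> F --> p.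
Proof.
move=> FF hS Kco Vc Vinj FK VF A; rewrite nbhsE => -[U [Uop Up] UA].
have VKU_closed : closed (V @` (K `&` ~` U)).
  apply: compact_closed => //; apply: continuous_compact.
    by apply: continuous_subspaceW Vc => x [].
  by apply: compact_closedI => //; exact: open_closedC.
have nbhs_Vp : nbhs (V p) (~` (V @` (K `&` ~` U))).
  apply: open_nbhs_nbhs; split; first exact: closed_openC.
  by move=> [x [Kx nUx] /(Vinj _ Kx) xp]; apply: nUx; rewrite xp.
have FV : F (V @^-1` (~` (V @` (K `&` ~` U)))) by exact: VF.
apply: filterS (filterI FK FV) => x [Kx nVx]; apply: UA.
by apply: contrapT => nUx; apply: nVx; exists x.
Qed.

Lemma box_compact (R : realType) (n : nat) (l u : 'rV[R]_n) :
  compact (box l u).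
Proof.
(* Seen as a product of segments, the box is compact by Tychonoff's theorem. *)
have -> : box l u =
    [set x : 'rV[R]_n | forall i, `[l ord0 i, u ord0 i]%classic (x ord0 i)].
  by apply/seteqP; split=> x /= xlu i; have := xlu i; rewrite in_itv.
by apply: (@rV_compact R n (fun i => `[l ord0 i, u ord0 i]%classic)) => i;
  exact: segment_compact.
Qed.

Theorem theorem3 (R : realType)
    (Op : forall k p : nat, ('rV[R]_k -> 'rV[R]_p) -> Prop)
    (n m : nat)
    (f : 'rV[R]_(n + m) -> 'rV[R]_n) (ctrl : 'rV[R]_n -> 'rV[R]_m)
    (f_graph : computation_graph Op f) (ctrl_graph : computation_graph Op ctrl)
    (g : 'rV[R]_n -> 'rV[R]_n) (g_def : g = closed_loop f ctrl)
    (xstar : 'rV[R]_n) (xstar_eq : g xstar = xstar)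
    (l u : 'rV[R]_n) (xstar_box : box l u xstar)
    (kappa : R) (kappa_gt0 : 0 < kappa)
    (V : 'rV[R]_n -> R) (V_cont : {within box l u, continuous V})
    (V_xstar : V xstar = 0) (V_pos : forall x, x <> xstar -> 0 < V x)
    (rho : R) (rho_gt0 : 0 < rho)
    (cond : forall x, box l u x ->
      (0 <= - lyapunov_residual g V kappa x /\ box l u (g x)) \/ rho <= V x) :
  [set x | box l u x /\ V x < rho] `<=` region_of_attraction g xstar.
Proof.
move=> x0 [x0_box Vx0]; rewrite /region_of_attraction /=.
have V_ge0 x : 0 <= V x.
  by have [->|/eqP /V_pos /ltW //] := eqVneq x xstar; rewrite V_xstar.
(* For [kappa > 1] the factor [1 - kappa] is negative. Truncating it at [0] still gives an upper
   bound because [V] is nonnegative, and makes multiplication by [q] monotone, as the induction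
   requires. *)
pose q := Num.max 0 (1 - kappa).
have q_ge0 : 0 <= q by rewrite le_max lexx.
have q_lt1 : q < 1 by rewrite gt_max ltr01 ltrBlDr ltrDl.
have step x : box l u x -> V x < rho -> box l u (g x) /\ V (g x) <= q * V x.
  move=> x_box Vx; have [[Fx gx_box]|] := cond _ x_box; last by rewrite leNgt Vx.
  split=> //; move: Fx; rewrite oppr_ge0 subr_le0 => /le_trans; apply.
  by rewrite ler_wpM2r// le_max lexx orbT.
(* The two claims need each other: as [q ^+ t <= 1], the bound keeps the state below level [rho],
   and together with membership in the box this lets [step] apply again. *)
have traj t : box l u (iter t g x0) /\ V (iter t g x0) <= q ^+ t * V x0.
  elim: t => [|t [t_box Vt]] /=; first by rewrite mul1r.
  have Vt_rho : V (iter t g x0) < rho.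
    apply: le_lt_trans Vt (le_lt_trans _ Vx0).
    by rewrite ler_piMl// exprn_ile1// ltW.
  have [t1_box Vt1] := step _ t_box Vt_rho; split=> //.
  by apply: le_trans Vt1 _; rewrite exprS -mulrA ler_wpM2l.
apply: (@cvg_of_image_cvg _ _ _ (box l u) V).
- exact: norm_hausdorff.
- exact: box_compact.
- exact: V_cont.
- move=> x _; rewrite V_xstar => Vx; apply: contrapT => /V_pos.
  by rewrite Vx ltxx.
(* The trajectory lies in the box from time [0] on. *)
- by exists 0%N => // t _; have [] := traj t.
- rewrite V_xstar.
  (* The upper sequence is [V x0 * q ^+ t], which tends to [0] since [0 <= q < 1]. *)
  apply: (@squeeze_cvgr _ _ _ _ (cst 0) (geometric (V x0) q)).
  + by apply: nearW => t; rewrite /= V_ge0 mulrC; have [] := traj t.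
  + exact: cvg_cst.
  + by apply: cvg_geometric; rewrite ger0_norm.
Qed.
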